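(* For every integer $j$ and every integer $k$, $$ s_k(j^2-2)=r_k(j)\, s_k(j), $$ where $(r_k(j))_k$ satisfies the same recurrence as $(s_k(j))_k$, namely $r_{k+2}(j)-j\,r_{k+1}(j)+r_k(j)=0$, with initial values $r_0(j)=1$, $r_1(j)=j-1$. Thus $s_k(j^2-2)$ is expressed as a product of two integers.
   Context: For an integer $n$, the sequence $(s_k(n))_{k\in\mathbb{Z}}$ is defined by $s_0(n)=1$, $s_1(n)=n+1$ and $s_{k+2}(n)=n\,s_{k+1}(n)-s_k(n)$ for all $k\in\mathbb{Z}$; $(r_k(n))_{k\in\mathbb{Z}}$ is defined by the same recurrence with $r_0(n)=1$, $r_1(n)=n-1$. *)

(* Defs.v *)
From mathcomp Require Import all_boot all_order all_algebra.
From mathcomp Require Import ring zify.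

Set Implicit Arguments.
Unset Strict Implicit.
Unset Printing Implicit Defensive.

Import GRing.Theory.
Local Open Scope ring_scope.

(* The pair (u_k, u_(k+1)) of consecutive terms of a sequence satisfying
   u_(k+2) = n u_(k+1) - u_k is moved one index up by [rec_up n] and one index
   down by [rec_down n]. *)
Definition rec_up (n : int) (p : int * int) : int * int :=
  (p.2, n * p.2 - p.1).

Definition rec_down (n : int) (p : int * int) : int * int :=
  (n * p.1 - p.2, p.1).

(* The two-sided sequence with u_0 = a, u_1 = b and u_(k+2) = n u_(k+1) - u_k
   for all k in Z; note that [Negz m] is -(m+1). *)
Definition two_sided_rec (n a b k : int) : int :=
  match k with
  | Posz m => (iter m (rec_up n) (a, b)).1
  | Negz m => (iter m.+1 (rec_down n) (a, b)).1
  end.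

(* The index comes first: [s k n] is s_k(n), and [r k n] is r_k(n). *)
Definition s (k n : int) : int := two_sided_rec n 1 (n + 1) k.

Definition r (k n : int) : int := two_sided_rec n 1 (n - 1) k.

Lemma two_sided_rec0 (n a b : int) : two_sided_rec n a b 0 = a.
Proof. by []. Qed.

Lemma two_sided_rec1 (n a b : int) : two_sided_rec n a b 1 = b.
Proof. by []. Qed.

Lemma two_sided_recSS (n a b k : int) :
  two_sided_rec n a b (k + 2) =
  n * two_sided_rec n a b (k + 1) - two_sided_rec n a b k.
Proof.
case: k => [m|[|[|m]]].
- have -> : Posz m + 2 = m.+2 by lia.
  by have -> : Posz m + 1 = m.+1 by lia.
- by rewrite /=; ring.
- by rewrite /=; ring.
- have -> : Negz m.+2 + 2 = Negz m by lia.
  have -> : Negz m.+2 + 1 = Negz m.+1 by lia.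
  by rewrite /two_sided_rec !iterS /=; ring.
Qed.

Lemma two_sided_rec_uniq (n a b : int) (u : int -> int) :
  u 0 = a -> u 1 = b -> (forall k, u (k + 2) = n * u (k + 1) - u k) ->
  u =1 two_sided_rec n a b.
Proof.
move=> u0 u1 uSS; set v := two_sided_rec n a b.
have vSS k : v (k + 2) = n * v (k + 1) - v k by exact: two_sided_recSS.
have pos (m : nat) : u m = v m /\ u (m%:Z + 1) = v (m%:Z + 1).
  elim: m => [|m [IH1 IH2]]; first by rewrite add0r u0 u1.
  have -> : Posz m.+1 = m%:Z + 1 by lia.
  have -> : m%:Z + 1 + 1 = m%:Z + 2 by lia.
  by rewrite uSS vSS IH1 IH2.
have neg (m : nat) : u (- m%:Z) = v (- m%:Z) /\ u (- m%:Z + 1) = v (- m%:Z + 1).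
  elim: m => [|m [IH1 IH2]]; first by rewrite oppr0 add0r u0 u1.
  have e1 : - Posz m.+1 + 1 = - m%:Z by lia.
  have e2 : - Posz m.+1 + 2 = - m%:Z + 1 by lia.
  have := uSS (- Posz m.+1); have := vSS (- Posz m.+1).
  rewrite e1 e2 IH1 IH2 => -> /eqP.
  by rewrite (inj_eq (addrI _)) (inj_eq oppr_inj) => /eqP ->.
by case=> m; [case: (pos m) | rewrite NegzE; case: (neg m.+1)].
Qed.

(* Main.v *)
Require Import Defs.
From mathcomp Require Import all_boot all_order all_algebra.
From mathcomp Require Import ring zify.

Set Implicit Arguments.
Unset Strict Implicit.
Unset Printing Implicit Defensive.

Import GRing.Theory.
Local Open Scope ring_scope.

(* The product r_k(j) s_k(j) satisfies the recurrence with parameter j^2 - 2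
   exactly when 2 (r_k s_k + r_(k+1) s_(k+1)) = j (r_k s_(k+1) + r_(k+1) s_k).
   The difference of the two sides is the polarization of the quadratic form
   x^2 - j x y + y^2, which the shift (x, y) |-> (y, j y - x) preserves, so it
   does not depend on k; it vanishes at k = 0. *)

Lemma shift_invariant_const (T : Type) (f : int -> T) :
  (forall k, f (k + 1) = f k) -> forall k, f k = f 0.
Proof.
move=> fS; elim/int_ind => [//|m IHm|m IHm].
  by rewrite -IHm -[RHS]fS; congr f; lia.
by rewrite -IHm -[LHS]fS; congr f; lia.
Qed.

Definition rec_polar (n : int) (u v : int -> int) (k : int) : int :=
  2 * (u k * v k + u (k + 1) * v (k + 1))
  - n * (u k * v (k + 1) + u (k + 1) * v k).

Lemma rec_polar_const (n a b c d k : int) :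
  let u := two_sided_rec n a b in let v := two_sided_rec n c d in
  rec_polar n u v k = rec_polar n u v 0.
Proof.
move=> u v; apply: shift_invariant_const => {}k; rewrite /rec_polar.
have -> : k + 1 + 1 = k + 2 by ring.
by rewrite /u /v !two_sided_recSS; ring.
Qed.

(** By invariance only index 0 matters, where the value is 2 (1 + (j - 1)(j + 1)) - j ((j + 1) + (j
    - 1)) = 2 j^2 - 2 j^2. *)
Lemma rec_polar_rs (j k : int) : rec_polar j (r^~ j) (s^~ j) k = 0.
Proof.
rewrite rec_polar_const /rec_polar add0r !two_sided_rec0 !two_sided_rec1.
by ring.
Qed.

Theorem theorem11 (j k : int) : s k (j ^+ 2 - 2) = r k j * s k j.
Proof.
apply/esym; apply: (two_sided_rec_uniq (u := fun k => r k j * s k j)) k => [||k].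
- by rewrite /r /s !two_sided_rec0.
(* The initial values match since (j - 1)(j + 1) = (j^2 - 2) + 1. *)
- by rewrite /r /s !two_sided_rec1; ring.
have := rec_polar_rs j k; rewrite /rec_polar /r /s !two_sided_recSS => polar0.
(* Once the terms of index k + 2 are expanded, the left side minus the right side is exactly
   [rec_polar] at k, so [polar0] is written in place of 0 and [ring] closes a polynomial
   identity. *)
by apply/eqP; rewrite -subr_eq0 -[X in _ == X]polar0; apply/eqP; ring.
Qed.
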